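(* Consider the scalar system $x_{k+1}=Ax_k+w_k$, $k=0,1,\dots$, with $A\ge 0$, $x_0\in[\underline X_0,\overline X_0]$ and $w_k\in[-W/2,W/2]$. Its state is sampled every $T$ steps, quantized to $r$ bits and communicated with latency $d\le T$ and message failure probability $p_e$ with perfect acknowledgments, using the sequential quantization and estimation scheme described in the context. If $$\Big(p_e+\frac{1-p_e}{2^r}\Big)A^T<1,$$ then the expected steady state estimation error satisfies $$\limsup_{\ell\to\infty}\mathbb E\,|x_{\ell T+d}-\hat x_{\ell T+d}|\;\le\;\frac12\,\frac{A^d+\big(p_e+\frac{1-p_e}{2^r}\big)(A^T-A^d)-1}{1-\big(p_e+\frac{1-p_e}{2^r}\big)A^T}\,\frac{W}{A-1},$$ where for $A=1$ the right-hand side is replaced by $$\frac{d+(p_e+(1-p_e)2^{-r})(T-d)}{(1-p_e)(1-2^{-r})}\,\frac W2 .$$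
   Context: **System.** $A\ge 0$ and $W>0$ are real numbers. $x_k\in\mathbb R$ evolves by $x_{k+1}=Ax_k+w_k$, where $x_0$ is an unknown element of the known interval $[\underline X_0,\overline X_0]\subset\mathbb R$ and $(w_k)_{k\ge0}$ is an unknown sequence with $w_k\in[-W/2,W/2]$. $A^T$ denotes the $T$-th power of $A$. The symbol $\frac{A^m-1}{A-1}$ in the scheme below means $\sum_{j=0}^{m-1}A^j$ (so it equals $m$ if $A=1$). **Communication model.** $T\ge1$, $r\ge 1$ and $0\le d\le T$ are integers and $p_e\in[0,1]$. For each $\ell=0,1,2,\dots$ the sensor samples $x_{\ell T}$ and sends an $r$-bit message about it, which requires a delay of $d$ time steps. At time $\ell T+d$ the message is either successfully decoded (probability $1-p_e$) or corrupted and discarded (probability $p_e$). The estimator knows which of the two occurred. Success/failure events of different messages are independent, and they do not depend on the state and disturbance. The estimator sends perfect acknowledgments to the sensor, so both sides know which messages were received. **Quantization and estimation scheme.** Sensor and estimator maintain an interval $[L_\ell,U_\ell]$ guaranteed to contain $x_{\ell T}$ before the $\ell$-th message is sent, with $[L_0,U_0]=[\underline X_0,\overline X_0]$. The sensor divides $[L_\ell,U_\ell]$ uniformly into $2^r$ (closed) bins of equal length and sends the index of a bin containing $x_{\ell T}$. - If the message fails, set $[L'_\ell,U'_\ell]=[L_\ell,U_\ell]$. - If the message succeeds, let $[L'_\ell,U'_\ell]$ be the transmitted bin, of length $(U_\ell-L_\ell)/2^r$. The estimates are $\hat x_{\ell T}=(L'_\ell+U'_\ell)/2$ and $\hat x_{\ell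 T+d}=A^d\hat x_{\ell T}$. The next interval is $$[L_{\ell+1},U_{\ell+1}]=\Big[A^TL'_\ell-\tfrac{A^T-1}{A-1}\tfrac W2,\;A^TU'_\ell+\tfrac{A^T-1}{A-1}\tfrac W2\Big].$$ **Expectation.** $\mathbb E$ is over the random decoding successes/failures. The bound is asserted for every $x_0\in[\underline X_0,\overline X_0]$ and every disturbance sequence with $w_k\in[-W/2,W/2]$. *)

(* Defs.v *)
From HB Require Import structures.
From mathcomp Require Import all_boot all_order all_algebra.
From mathcomp Require Import all_classical all_reals all_analysis.

Set Implicit Arguments.
Unset Strict Implicit.
Unset Printing Implicit Defensive.
Import Order.TTheory GRing.Theory Num.Theory.

Local Open Scope ring_scope.

Definition trajectory (R : realType) (A : R) (x w : nat -> R) : Prop :=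
  forall k, x k.+1 = A * x k + w k.

(* The quotient (A ^+ m - 1) / (A - 1), read as m when A = 1. *)
Definition geom_sum (R : realType) (A : R) (m : nat) : R :=
  \sum_(j < m) A ^+ j.

(* Intervals [L, U] are represented by the pair (L, U) of their endpoints. *)
Definition in_bounds (R : realType) (I : R * R) (y : R) : Prop :=
  I.1 <= y <= I.2.

Definition bin (R : realType) (r : nat) (I : R * R) (i : 'I_(2 ^ r)) : R * R :=
  let h := (I.2 - I.1) / 2 ^+ r in
  (I.1 + i%:R * h, I.1 + i.+1%:R * h).

(* Adjacent closed bins share an endpoint, so "a bin containing the state"
   involves a choice there.  An encoder makes it, from the acknowledgments
   received so far, the current interval and the sampled state; any rule is
   allowed as long as the chosen bin contains the state. *)
Definition encoder (R : realType) (r : nat) : Type :=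
  seq bool -> R * R -> R -> 'I_(2 ^ r).

Definition valid_encoder (R : realType) (r : nat) (enc : encoder R r) : Prop :=
  forall (h : seq bool) (I : R * R) (y : R),
    in_bounds I y -> in_bounds (bin I (enc h I y)) y.

(* [L'_l, U'_l] from I = [L_l, U_l]; s l tells whether the l-th message is
   successfully decoded. *)
Definition update (R : realType) (T r : nat) (enc : encoder R r)
    (x : nat -> R) (s : nat -> bool) (l : nat) (I : R * R) : R * R :=
  if s l then bin I (enc (mkseq s l) I (x (l * T)%N)) else I.

(* [L_(l+1), U_(l+1)] from I = [L'_l, U'_l] *)
Definition predict (R : realType) (A W : R) (T : nat) (I : R * R) : R * R :=
  (A ^+ T * I.1 - geom_sum A T * (W / 2),
   A ^+ T * I.2 + geom_sum A T * (W / 2)).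

(* [L_l, U_l], starting from [L_0, U_0] = X0 *)
Fixpoint prior (R : realType) (A W : R) (T r : nat) (enc : encoder R r)
    (X0 : R * R) (x : nat -> R) (s : nat -> bool) (l : nat) : R * R :=
  if l is k.+1 then
    predict A W T (update T enc x s k (prior A W T enc X0 x s k))
  else X0.

Definition posterior (R : realType) (A W : R) (T r : nat) (enc : encoder R r)
    (X0 : R * R) (x : nat -> R) (s : nat -> bool) (l : nat) : R * R :=
  update T enc x s l (prior A W T enc X0 x s l).

(* The estimate of x (l * T), available once the l-th message has arrived *)
Definition estimate (R : realType) (A W : R) (T r : nat) (enc : encoder R r)
    (X0 : R * R) (x : nat -> R) (s : nat -> bool) (l : nat) : R :=
  let I := posterior A W T enc X0 x s l in (I.1 + I.2) / 2.

(* The estimate of x (l * T + d) *)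
Definition delayed_estimate (R : realType) (A W : R) (T d r : nat)
    (enc : encoder R r) (X0 : R * R) (x : nat -> R) (s : nat -> bool)
    (l : nat) : R :=
  A ^+ d * estimate A W T enc X0 x s l.

Definition independent_events (d : measure_display) (Omega : measurableType d)
    (R : realType) (P : probability Omega R) (E : nat -> set Omega) : Prop :=
  forall J : seq nat, uniq J ->
    P (\bigcap_(j in [set` J]) E j)%classic = (\prod_(j <- J) P (E j))%E.

(* The successes s l are independent, each of probability 1 - pe. *)
Definition erasure_channel (d : measure_display) (Omega : measurableType d)
    (R : realType) (P : probability Omega R) (pe : R)
    (s : nat -> Omega -> bool) : Prop :=
  let E := fun l => [set omega | s l omega]%classic in
  [/\ forall l, measurable (E l),
      forall l, P (E l) = (1 - pe)%:E
    & independent_events P E].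

(* Mean of the factor by which one message shrinks the interval *)
Definition mean_shrink (R : realType) (pe : R) (r : nat) : R :=
  pe + (1 - pe) / 2 ^+ r.

(* Main.v *)
(* The length of the interval [L_l, U_l] depends only on the successes of the
   messages before l, not on the state: it is multiplied by 2^-r at a success
   and then mapped by y |-> A^T y + W (1 + ... + A^(T-1)).  With q the mean
   shrinking factor, independence gives E len_(l+1) = q A^T E len_l + const, which
   converges since q A^T < 1.  The estimation error at time l T + d is at most
   A^d times half the length of [L'_l, U'_l], whose mean is q E len_l, plus the
   contribution (W / 2) (1 + ... + A^(d-1)) of the disturbances. *)
Require Import Defs.
From HB Require Import structures.
From mathcomp Require Import all_boot all_order all_algebra.
From mathcomp Require Import ring lra.
From mathcomp Require Import all_classical all_reals all_analysis.

Set Implicit Arguments.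
Unset Strict Implicit.
Unset Printing Implicit Defensive.
Import Order.TTheory GRing.Theory Num.Theory.
Import numFieldNormedType.Exports.

Local Open Scope ring_scope.

(** * Deviation of the disturbed system from the free one *)

Section Dynamics.
Variables (R : realType) (A : R).

Lemma geom_sumS (m : nat) : geom_sum A m.+1 = A * geom_sum A m + 1.
Proof.
rewrite /geom_sum big_ord_recl expr0 addrC mulr_sumr; congr (_ + _).
by apply: eq_bigr => i _; rewrite exprS.
Qed.

Lemma geom_sum1 (m : nat) : A = 1 -> geom_sum A m = m%:R.
Proof.
move=> ->; rewrite /geom_sum (eq_bigr (fun=> 1)) => [|i _]; last exact: expr1n.
by rewrite sumr_const card_ord.
Qed.

Lemma geom_sumE (m : nat) : A != 1 -> geom_sum A m = (A ^+ m - 1) / (A - 1).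
Proof.
rewrite -subr_eq0 => A1; apply: (canRL (mulfK A1)).
by rewrite mulrC [RHS]subrX1.
Qed.

(** Each step multiplies the deviation by [A] and adds at most [c], which is the recursion
    [geom_sumS]. *)
Lemma trajectory_dist (c : R) (x w : nat -> R) (n m : nat) :
  0 <= A -> trajectory A x w -> (forall k, - c <= w k <= c) ->
  `|x (n + m)%N - A ^+ m * x n| <= geom_sum A m * c.
Proof.
move=> A0 hx hw; elim: m => [|m IH].
  by rewrite addn0 expr0 mul1r subrr normr0 /geom_sum big_ord0 mul0r.
rewrite addnS hx exprS geom_sumS.
have -> : A * x (n + m)%N + w (n + m)%N - A * A ^+ m * x n =
    A * (x (n + m)%N - A ^+ m * x n) + w (n + m)%N by ring.
rewrite (le_trans (ler_normD _ _))// mulrDl mul1r lerD//; last by rewrite ler_norml.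
by rewrite normrM ger0_norm// -mulrA ler_wpM2l.
Qed.

End Dynamics.

(** * Widths of the intervals and containment of the state *)

Section Intervals.
Variables (R : realType) (A W : R) (T r : nat) (enc : encoder R r).
Variables (X0 : R * R) (x w : nat -> R) (s : nat -> bool).

Let L := prior A W T enc X0 x s.
Let L' := posterior A W T enc X0 x s.

(** All bins have equal length, so the encoder's choice drops out. Reading [s l] as 0 or 1 merges
    both outcomes into one formula affine in [s l], ready for taking means. *)
Lemma width_posterior (l : nat) :
  (L' l).2 - (L' l).1
    = (1 - (1 - 2 ^- r) * (s l)%:R) * ((L l).2 - (L l).1).
Proof.
rewrite /L' /posterior /update -/(L l) /bin; case: (s l) => /=; last by ring.
by rewrite -natr1; ring.
Qed.

Lemma width_prior (l : nat) :
  (L l.+1).2 - (L l.+1).1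
    = geom_sum A T * W + A ^+ T * ((L' l).2 - (L' l).1).
Proof. by rewrite /= -/(L' l); field. Qed.

Hypotheses (A0 : 0 <= A) (hx0 : X0.1 <= x 0%N <= X0.2).
Hypotheses (hw : forall k, - (W / 2) <= w k <= W / 2) (hx : trajectory A x w).
Hypothesis henc : valid_encoder enc.

(** A valid encoder keeps the state in the chosen bin, and the margin added by [predict] is exactly
    the bound of [trajectory_dist] over [T] steps. *)
Lemma in_posterior (l : nat) : in_bounds (L' l) (x (l * T)%N).
Proof.
have upd k : in_bounds (L k) (x (k * T)%N) -> in_bounds (L' k) (x (k * T)%N).
  by rewrite /L' /posterior /update; case: ifP => // _; exact: henc.
apply: (upd l); elim: l => [|l /upd/andP[IHl IHu]]; first by rewrite mul0n.
have := trajectory_dist (l * T) T A0 hx hw.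
rewrite -mulSnr ler_norml => /andP[hl hu].
have AT0 : 0 <= A ^+ T by exact: exprn_ge0.
have {}IHl := ler_wpM2l AT0 IHl; have {}IHu := ler_wpM2l AT0 IHu.
by apply/andP; rewrite /= -/(L' l); split; lra.
Qed.

Lemma estimation_error (d l : nat) :
  `|x (l * T + d)%N - delayed_estimate A W T d enc X0 x s l|
    <= A ^+ d / 2 * ((L' l).2 - (L' l).1) + geom_sum A d * (W / 2).
Proof.
have /andP[hl hu] := in_posterior l.
rewrite /delayed_estimate /estimate -/(L' l).
have -> : x (l * T + d)%N - A ^+ d * (((L' l).1 + (L' l).2) / 2)
  = A ^+ d * (x (l * T)%N - ((L' l).1 + (L' l).2) / 2)
    + (x (l * T + d)%N - A ^+ d * x (l * T)%N) by ring.
apply: (le_trans (ler_normD _ _)); apply: lerD; last exact: trajectory_dist.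
rewrite normrM ger0_norm ?exprn_ge0// -mulrA ler_wpM2l ?exprn_ge0//.
by rewrite ler_norml; apply/andP; split; lra.
Qed.

End Intervals.

(** * Limits of affine iterations and upper limits *)

Section Limits.
Local Open Scope classical_set_scope.
Variable R : realType.

(** The distance to the fixed point [b / (1 - a)] is a geometric sequence of ratio [a]. *)
Lemma cvg_affine_iter (a b m : R) : 0 <= a -> a < 1 ->
  iter n (fun y => b + a * y) m @[n --> \oo] --> b / (1 - a).
Proof.
move=> a0 a1; have a1' : 1 - a != 0 by rewrite subr_eq0 eq_sym lt_eqF.
have iterE n : iter n (fun y => b + a * y) m =
    b / (1 - a) + geometric (m - b / (1 - a)) a n.
  elim: n => [|n IH]; first by rewrite /= expr0; ring.
  by rewrite iterS IH /= exprS; field.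
rewrite (funext iterE).
have cg : geometric (m - b / (1 - a)) a n @[n --> \oo] --> (0 : R).
  by apply: cvg_geometric; rewrite ger0_norm.
by have := cvgD (cvg_cst (b / (1 - a))) cg; rewrite addr0; exact.
Qed.

Lemma limn_esup_le_limit (u v : nat -> \bar R) (l : \bar R) :
  (forall n, u n <= v n)%E -> v n @[n --> \oo] --> l ->
  (limn_esup u <= l)%E.
Proof.
move=> uv vl; have [_ <-] := cvg_limn_einf_sup vl; rewrite !limn_esup_lim.
apply: lee_lim; [exact: is_cvg_esups|exact: is_cvg_esups|apply: nearW => n].
apply: ge_ereal_sup => _ [k nk <-]; apply: le_trans (uv k) _.
by apply: ereal_sup_ubound; exists k.
Qed.

End Limits.

(** * Means over the erasure channel *)

Section Expectation.
Variables (disp : measure_display) (Omega : measurableType disp).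
Variables (R : realType) (P : probability Omega R).

(* No measurability is required: the integral of a nonnegative function is a
   supremum over the simple functions below it. *)
Lemma le_expectation (X Y : Omega -> R) :
  (forall t, 0 <= X t) -> (forall t, X t <= Y t) -> ('E_P[X] <= 'E_P[Y])%E.
Proof.
move=> X0 XY; have Y0 t := le_trans (X0 t) (XY t).
rewrite unlock !ge0_integralTE; try by move=> t; rewrite lee_fin.
apply: le_ereal_sup => _ [h hX <-]; exists h => // t.
by apply: le_trans (hX t) _; rewrite lee_fin.
Qed.

(** Integrability travels with the value because linearity of the expectation requires it. *)
Definition has_mean (X : Omega -> R) (e : R) : Prop :=
  X \in Lfun P 1%E /\ ('E_P[X] = e%:E)%E.

Lemma eq_has_mean (X Y : Omega -> R) (e e' : R) :
  (forall t, X t = Y t) -> e = e' -> has_mean X e -> has_mean Y e'.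
Proof. by move=> /funext -> ->. Qed.

Lemma has_mean_cst (e : R) : has_mean (cst e) e.
Proof. by split; [exact: Lfun_cst|exact: expectation_cst]. Qed.

Lemma has_mean_indic (B : set Omega) (e : R) :
  measurable B -> P B = e%:E -> has_mean \1_B e.
Proof.
move=> mB PB; split; last by rewrite expectation_indic.
by apply/Lfun1_integrable; exact: integrable_indic.
Qed.

Lemma has_mean_comb (u v : R) (X Y : Omega -> R) (e e' : R) :
  has_mean X e -> has_mean Y e' ->
  has_mean (fun t => u * X t + v * Y t) (u * e + v * e').
Proof.
move=> [LX EX] [LY EY].
have -> : (fun t => u * X t + v * Y t) = (u \o* X) \+ (v \o* Y).
  by apply/funext => t /=; rewrite ![_ * u]mulrC ![_ * v]mulrC.
have LuX : u \o* X \in Lfun P 1%E by exact: Lfun_scale.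
have LvY : v \o* Y \in Lfun P 1%E by exact: Lfun_scale.
split; last by rewrite expectationD// !expectationZl// EX EY.
by rewrite rpredD.
Qed.

Variables (pe : R) (s : nat -> Omega -> bool).
Hypothesis hs : erasure_channel P pe s.

(** The product is the indicator of the joint success event, whose probability factors by
    independence. *)
Lemma has_mean_successes (J : seq nat) : uniq J ->
  has_mean (fun t => \prod_(j <- J) (s j t)%:R) ((1 - pe) ^+ size J).
Proof.
case: hs => mE PE indE uJ.
have -> : (fun t => \prod_(j <- J) (s j t)%:R : R) =
    \1_(\bigcap_(j in [set` J]) [set t | s j t])%classic.
  apply/funext => t; rewrite indicE -natr_prod; congr (_%:R).
  have natr_and : {morph nat_of_bool : u v / u && v >-> (u * v)%N} by do 2!case.
  rewrite -(big_morph _ natr_and (erefl : true = 1%N :> nat)) big_all.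
  congr nat_of_bool; apply/allP/idP => [h|].
    by rewrite inE => j /= /h.
  by rewrite inE => h j /h.
apply: has_mean_indic; first by apply: fin_bigcap_measurable.
rewrite indE//; elim: J {uJ} => [|j J IH]; first by rewrite big_nil.
by rewrite big_cons PE IH -EFinM exprS.
Qed.

Variables (a b c m : R) (f : nat -> Omega -> R).
Hypothesis f0 : forall t, f 0%N t = m.
Hypothesis fS : forall l t,
  f l.+1 t = b + a * ((1 - c * (s l t)%:R) * f l t).

(** The recurrence [fS] with [s l] replaced by its mean [1 - pe]. *)
Let mean l := iter l (fun y => b + (1 - c * (1 - pe)) * a * y) m.

(* Carrying along a product of future successes makes the independence of
   [s l] from [f l] part of the induction hypothesis. *)
Lemma has_mean_recurrence_successes (l : nat) (J : seq nat) :
  uniq J -> {in J, forall j, (l <= j)%N} ->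
  has_mean (fun t => f l t * \prod_(j <- J) (s j t)%:R)
    (mean l * (1 - pe) ^+ size J).
Proof.
elim: l J => [|l IH] J uJ lJ.
  apply: eq_has_mean
    (has_mean_comb m 0 (has_mean_successes uJ) (has_mean_cst 0)) => [t|/=].
    by rewrite f0 mul0r addr0.
  by rewrite mul0r addr0.
have lNJ : l \notin J by apply/negP => /lJ; rewrite ltnn.
have hJ := IH J uJ (fun j jJ => ltnW (lJ j jJ)).
(* The factor [s l] coming from [fS] joins the product, so the mixed term is the induction
   hypothesis at [l :: J]. *)
have hlJ : has_mean (fun t => f l t * \prod_(j <- l :: J) (s j t)%:R)
    (mean l * (1 - pe) ^+ (size J).+1).
  apply: IH => [|j]; first by rewrite /= lNJ.
  by rewrite inE => /predU1P[->//|/lJ/ltnW].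
apply: eq_has_mean (has_mean_comb b 1 (has_mean_successes uJ)
  (has_mean_comb a (- (a * c)) hJ hlJ)) => [t|].
  by rewrite fS big_cons; ring.
by rewrite /mean iterS exprS; ring.
Qed.

Lemma has_mean_recurrence_affine (l : nat) (u v : R) :
  has_mean (fun t => u * ((1 - c * (s l t)%:R) * f l t) + v)
    (u * ((1 - c * (1 - pe)) * mean l) + v).
Proof.
have h0 : has_mean (fun t => f l t * \prod_(j <- [::]) (s j t)%:R)
    (mean l * (1 - pe) ^+ 0) by exact: has_mean_recurrence_successes.
have h1 : has_mean (fun t => f l t * \prod_(j <- [:: l]) (s j t)%:R)
    (mean l * (1 - pe) ^+ 1).
  by apply: has_mean_recurrence_successes => // j; rewrite inE => /eqP ->.
apply: eq_has_mean (has_mean_comb 1 v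
  (has_mean_comb u (- (u * c)) h0 h1) (has_mean_cst 1)) => [t|].
  by rewrite big_nil big_seq1 /=; ring.
by rewrite expr0 expr1; ring.
Qed.

End Expectation.

Theorem theorem2 (R : realType) (A W pe : R) (T d r : nat) (X0l X0u : R)
    (x w : nat -> R) (enc : encoder R r)
    (disp : measure_display) (Omega : measurableType disp)
    (P : probability Omega R) (s : nat -> Omega -> bool)
    (hA : 0 <= A) (hW : 0 < W) (hpe : 0 <= pe <= 1)
    (hT : (1 <= T)%N) (hr : (1 <= r)%N) (hd : (d <= T)%N)
    (hx0 : X0l <= x 0%N <= X0u)
    (hw : forall k, - (W / 2) <= w k <= W / 2)
    (hx : trajectory A x w)
    (henc : valid_encoder enc)
    (hs : erasure_channel P pe s)
    (hq : mean_shrink pe r * A ^+ T < 1) :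
  (limn_esup (fun l : nat =>
     'E_P[ (fun omega : Omega =>
              `| x (l * T + d)%N
                 - delayed_estimate A W T d enc (X0l, X0u) x
                     (fun k => s k omega) l |)%R ])
   <= (if A == 1 then
         (d%:R + mean_shrink pe r * (T - d)%:R)
         / ((1 - pe) * (1 - 2 ^- r)) * (W / 2)
       else
         2^-1 * ((A ^+ d + mean_shrink pe r * (A ^+ T - A ^+ d) - 1)
                 / (1 - mean_shrink pe r * A ^+ T))
         * (W / (A - 1)))%:E)%E.
Proof.
set g := geom_sum A T; set q := mean_shrink pe r.
(* The fraction of the width removed by a success; the random factor [1 - c * s l] then has mean
   [q]. *)
pose c : R := 1 - 2 ^- r.
have qE : 1 - c * (1 - pe) = q by rewrite /q /mean_shrink /c; ring.
have /andP[pe0 pe1] := hpe.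
have q0 : 0 <= q.
  by rewrite addr_ge0// divr_ge0 ?subr_ge0// exprn_ge0.
pose f l omega := let I := prior A W T enc (X0l, X0u) x (fun k => s k omega) l in
  I.2 - I.1.
have f0 t : f 0%N t = X0u - X0l by [].
have fS l t : f l.+1 t = g * W + A ^+ T * ((1 - c * (s l t)%:R) * f l t).
  by rewrite /f width_prior width_posterior.
pose mu l := iter l (fun y => g * W + q * A ^+ T * y) (X0u - X0l).
apply: (@limn_esup_le_limit _ _
  (fun l => (A ^+ d / 2 * (q * mu l) + geom_sum A d * (W / 2))%:E)).
  move=> l; have [_] := has_mean_recurrence_affine hs f0 fS l
    (A ^+ d / 2) (geom_sum A d * (W / 2)).
  rewrite qE => <-; apply: le_expectation => [t|t]; first exact: normr_ge0.
  have := @estimation_error _ A W T r enc (X0l, X0u) x w (s^~ t)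
    hA hx0 hw hx henc d l.
  by rewrite width_posterior.
set B := (X in X%:E).
(* The limit replaces [mu l] by the fixed point of its iteration; matching it with the stated bound
   is algebra. *)
suff -> : B = A ^+ d / 2 * (q * (g * W / (1 - q * A ^+ T)))
    + geom_sum A d * (W / 2).
  apply: cvg_EFin; first exact: nearW.
  apply: cvgD; last exact: cvg_cst.
  apply: cvgMr; apply: cvgMr; apply: cvg_affine_iter => //.
  by rewrite mulr_ge0// exprn_ge0.
rewrite /B /g; case: ifPn => [/eqP A1|A1].
  (* For [A = 1] the hypothesis [hq] becomes [q < 1], so this denominator is nonzero. *)
  have p1 : (1 - pe) * (1 - 2 ^- r) = 1 - q by rewrite -qE /c; ring.
  move: hq; rewrite p1 !geom_sum1// A1 !expr1n mulr1 -/q natrB// => q1.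
  by field; rewrite subr_eq0 gt_eqF.
rewrite !geom_sumE// -/q; field.
by rewrite !subr_eq0 A1 /= gt_eqF.
Qed.
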